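(* Let $V$ be a finite-dimensional irreducible $\mathfrak{W}_q$-module. Then there exists a unique quadruple $(m,n,\delta,\lambda)$ with $m,n\in\mathbb N$, $\delta\in\{\pm1\}$, $\lambda\in\mathbb C\setminus\{0\}$ such that $V$ is isomorphic to the $\mathfrak{W}_q$-module $(L_m\otimes L_n)^{\delta,\lambda}$.
   Context: Throughout, $q$ is a nonzero complex number that is not a root of unity; $[x,y]=xy-yx$, $[x,y]_q=qxy-q^{-1}yx$, $[n]_q=\frac{q^n-q^{-n}}{q-q^{-1}}$. $\mathfrak{W}_q$ is the algebra over $\mathbb C$ generated by $E_1,E_2,F_1,F_2,K_1^{\pm1},K_2^{\pm1},I^{\pm1}$ subject to: $I$ is central; $II^{-1}=I^{-1}I=1$, $K_1K_1^{-1}=K_1^{-1}K_1=1$, $K_2K_2^{-1}=K_2^{-1}K_2=1$; $[K_1,E_2]=[K_1,F_2]=[K_1,K_2]=[K_2,E_1]=[K_2,F_1]=0$; $[E_1,K_1]_q=[K_1,F_1]_q=[E_2,K_2]_q=[K_2,F_2]_q=0$; $[E_1,E_2]=[E_1,F_2]=[F_1,E_2]=[F_1,F_2]=0$; $[E_1,F_1]=\frac{K_1-IK_1^{-1}}{q-q^{-1}}$; $[E_2,F_2]=\frac{IK_2-K_2^{-1}}{q-q^{-1}}$. For $m,n\in\mathbb N$, $\delta\in\{\pm1\}$, $\lambda\in\mathbb C\setminus\{0\}$, $(L_m\otimes L_n)^{\delta,\lambda}$ denotes the $(m+1)(n+1)$-dimensional $\mathfrak{W}_q$-module with basis $v_i^{(m)}\otimes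 v_j^{(n)}$ ($0\le i\le m$, $0\le j\le n$) on which: $E_1v_i^{(m)}\otimes v_j^{(n)}=\lambda[i]_q[m-i+1]_qv_{i-1}^{(m)}\otimes v_j^{(n)}$ (zero if $i=0$); $E_2v_i^{(m)}\otimes v_j^{(n)}=\delta\lambda[j]_q[n-j+1]_qv_i^{(m)}\otimes v_{j-1}^{(n)}$ (zero if $j=0$); $F_1v_i^{(m)}\otimes v_j^{(n)}=v_{i+1}^{(m)}\otimes v_j^{(n)}$ (zero if $i=m$); $F_2v_i^{(m)}\otimes v_j^{(n)}=v_i^{(m)}\otimes v_{j+1}^{(n)}$ (zero if $j=n$); $K_1$ acts on $v_i^{(m)}\otimes v_j^{(n)}$ by $\lambda q^{m-2i}$; $K_2$ by $\delta\lambda^{-1}q^{n-2j}$; $I$ by $\lambda^2$. (Equivalently it is the pullback via $E_i\mapsto E_i$ etc. of $L_m\otimes L_n$, with $L_n$ the $(n+1)$-dimensional irreducible $U_q(\mathfrak{sl}_2)$-module of type $1$, twisted by the automorphism $E_1\mapsto\lambda E_1$, $E_2\mapsto\delta\lambda E_2$, $F_i\mapsto F_i$, $K_1^{\pm1}\mapsto\lambda^{\pm1}K_1^{\pm1}$, $K_2^{\pm1}\mapsto\delta\lambda^{\mp1}K_2^{\pm1}$, $I^{\pm1}\mapsto\lambda^{\pm2}I^{\pm1}$.) *)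

(* Defs.v *)
From HB Require Import structures.
From mathcomp Require Import all_boot all_order all_algebra.
From mathcomp Require Import complex Rstruct.
Set Implicit Arguments. Unset Strict Implicit. Unset Printing Implicit Defensive.
Import Order.TTheory GRing.Theory Num.Theory.
Local Open Scope ring_scope.

Notation C := (complex Rdefinitions.R).

Definition qint (q : C) (n : nat) : C := (q ^+ n - q ^- n) / (q - q^-1).

(* A finite-dimensional representation: the images of the generators
   E1 E2 F1 F2 K1 K2 I of W_q as matrices acting on column vectors of C^wdim. *)
Record wrep := WRep {
  wdim : nat;
  wE1 : 'M[C]_wdim; wE2 : 'M[C]_wdim; wF1 : 'M[C]_wdim; wF2 : 'M[C]_wdim;
  wK1 : 'M[C]_wdim; wK2 : 'M[C]_wdim; wI : 'M[C]_wdim }.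

Definition mcomm d (x y : 'M[C]_d) := x *m y - y *m x.
Definition qmcomm (q : C) d (x y : 'M[C]_d) := q *: (x *m y) - q^-1 *: (y *m x).

Definition is_Wmod (q : C) (V : wrep) : Prop :=
  let E1 := wE1 V in let E2 := wE2 V in let F1 := wF1 V in let F2 := wF2 V in
  let K1 := wK1 V in let K2 := wK2 V in let I := wI V in
  [/\ K1 \in unitmx, K2 \in unitmx & I \in unitmx] /\
  [/\
      [/\ mcomm I E1 = 0, mcomm I E2 = 0, mcomm I F1 = 0 & mcomm I F2 = 0] /\
        (mcomm I K1 = 0 /\ mcomm I K2 = 0),
      [/\ mcomm K1 E2 = 0, mcomm K1 F2 = 0, mcomm K1 K2 = 0,
          mcomm K2 E1 = 0 & mcomm K2 F1 = 0],
      [/\ qmcomm q E1 K1 = 0, qmcomm q K1 F1 = 0, qmcomm q E2 K2 = 0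
          & qmcomm q K2 F2 = 0],
      [/\ mcomm E1 E2 = 0, mcomm E1 F2 = 0, mcomm F1 E2 = 0 & mcomm F1 F2 = 0]
    & mcomm E1 F1 = (q - q^-1)^-1 *: (K1 - I *m invmx K1) /\
      mcomm E2 F2 = (q - q^-1)^-1 *: (I *m K2 - invmx K2)].

Definition wgens (V : wrep) : seq 'M[C]_(wdim V) :=
  [:: wE1 V; wE2 V; wF1 V; wF2 V; wK1 V; invmx (wK1 V); wK2 V; invmx (wK2 V);
      wI V; invmx (wI V)].

(* Irreducible: nonzero, and the only subspaces stable under all generators
   are 0 and the whole space.  A subspace is the row space of U (its rows are
   the transposed vectors), so stability under A is (U *m A^T <= U). *)
Definition wirreducible (V : wrep) : Prop :=
  (0 < wdim V)%N /\
  forall U : 'M[C]_(wdim V),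
    (forall A, A \in wgens V -> (U *m A^T <= U)%MS) ->
    U = 0 \/ row_full U.

Definition wiso (V W : wrep) : Prop :=
  exists (P : 'M[C]_(wdim W, wdim V)) (Q : 'M[C]_(wdim V, wdim W)),
    [/\ P *m Q = 1%:M, Q *m P = 1%:M,
        [/\ P *m wE1 V = wE1 W *m P, P *m wE2 V = wE2 W *m P,
            P *m wF1 V = wF1 W *m P & P *m wF2 V = wF2 W *m P]
      & [/\ P *m wK1 V = wK1 W *m P, P *m wK2 V = wK2 W *m P
            & P *m wI V = wI W *m P]].

(* The module (L_m (x) L_n)^{delta,lambda}: basis vector v_i (x) v_j is the
   index a = i * (n+1) + j of 'I_((m+1)(n+1)); entry (a,b) of a matrix is the
   coefficient of basis vector a in the image of basis vector b. *)
Section Lmod.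
Variables (q : C) (m n : nat) (dl lam : C).
Let N := n.+1.
Let D := (m.+1 * n.+1)%N.
Let fi (a : 'I_D) : nat := (a %/ N)%N.
Let fj (a : 'I_D) : nat := (a %% N)%N.

Definition LE1 : 'M[C]_D := \matrix_(a, b)
  if ((fi a).+1 == fi b) && (fj a == fj b)
  then lam * qint q (fi b) * qint q (m - fi b + 1) else 0.
Definition LE2 : 'M[C]_D := \matrix_(a, b)
  if (fi a == fi b) && ((fj a).+1 == fj b)
  then dl * lam * qint q (fj b) * qint q (n - fj b + 1) else 0.
Definition LF1 : 'M[C]_D := \matrix_(a, b)
  if (fi a == (fi b).+1) && (fj a == fj b) then 1 else 0.
Definition LF2 : 'M[C]_D := \matrix_(a, b)
  if (fi a == fi b) && (fj a == (fj b).+1) then 1 else 0.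
Definition LK1 : 'M[C]_D := \matrix_(a, b)
  if a == b then lam * q ^ ((m%:Z - (fi b).*2%:Z)%R) else 0.
Definition LK2 : 'M[C]_D := \matrix_(a, b)
  if a == b then dl * lam^-1 * q ^ ((n%:Z - (fj b).*2%:Z)%R) else 0.
Definition LI : 'M[C]_D := \matrix_(a, b) if a == b then lam ^+ 2 else 0.

Definition Lmod : wrep := @WRep D LE1 LE2 LF1 LF2 LK1 LK2 LI.
End Lmod.

(* Main.v *)
Require Import Defs.
From HB Require Import structures.
From mathcomp Require Import all_boot all_order all_algebra.
From mathcomp Require Import complex Rstruct ring zify.
Import Order.TTheory GRing.Theory Num.Theory.
Local Open Scope ring_scope.

(* A common eigenvector of K1, K2, I is raised by E1, then by E2, to a highest
   weight vector v; this stops because E1, E2, F1, F2, which q-commute with an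
   invertible K with ratio q^2 or q^-2, are nilpotent.  If F1^(m+1) and F2^(n+1)
   are the first powers killing v, the sl2 computation forces the K1-weight of v
   to be lam q^m and I to act by lam^2, and likewise I K2 to act on v by
   mu q^n with mu^2 = lam^2, so mu = dl lam with dl = 1 or -1.  The map
   v_i (x) v_j |-> F1^i F2^j v is then an intertwiner from the model module; it
   is onto by irreducibility, and injective because a nonzero vector of its
   kernel can be raised to a multiple of the highest weight vector.  Uniqueness:
   the model has a single highest weight line, whose weights
   (lam q^m, dl lam^-1 q^n, lam^2) determine the quadruple, first m and n by
   squaring, since lam^2 and dl^2 are known. *)

(** * Nilpotency of a matrix that commutes up to a scalar with an invertible one *)

Lemma expr_not_unity_inj (F : fieldType) (r : F) :
  r != 0 -> (forall k, (0 < k)%N -> r ^+ k != 1) -> injective (GRing.exp r).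
Proof.
move=> r0 hr i j; wlog lij : i j / (i <= j)%N => [H|eij].
  by case: (leqP i j) => [/H//|/ltnW/H H' /esym/H'].
apply/eqP; rewrite eqn_leq lij /= leqNgt; apply/negP => ltij.
have := hr (j - i)%N; rewrite subn_gt0 => /(_ ltij)/eqP; apply.
have ri : r ^+ i != 0 by rewrite expf_neq0.
by apply: (mulIf ri); rewrite -exprD subnK // mul1r.
Qed.

(** If [v] is a row eigenvector of [E] for [a], then [v *m K] is one for [r^-1 * a]. With [a]
    nonzero this would give [d.+1] distinct roots of a characteristic polynomial of degree [d]. *)
Lemma skew_commute_eigenvalue_eq0 (F : fieldType) d (K E : 'M[F]_d) (r a : F) :
    r != 0 -> (forall k, (0 < k)%N -> r ^+ k != 1) ->
    K \in unitmx -> E *m K = r *: (K *m E) -> eigenvalue E a -> a = 0.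
Proof.
move=> r0 hr uK EK ea; apply/eqP/negPn/negP => a0.
have ek k : eigenvalue E (r ^- k * a).
  elim: k => [|k /eigenvalueP[v vE v0]]; first by rewrite expr0 invr1 mul1r.
  apply/eigenvalueP; exists (v *m K); last first.
    by apply: contraNneq v0 => vK; rewrite -(mulmxK uK v) vK mul0mx.
  have -> : v *m K *m E = r^-1 *: (v *m E *m K).
    by rewrite -!mulmxA EK -scalemxAr scalerA mulVf // scale1r.
  by rewrite vE -scalemxAl scalerA exprS invfM mulrA.
have := @max_poly_roots _ (char_poly E) [seq r ^- k * a | k <- iota 0 d.+1].
rewrite size_map size_iota size_char_poly ltnn => H; suff: false by [].
apply: H.
- exact/monic_neq0/char_poly_monic.
- by apply/allP => _ /mapP[k _ ->]; rewrite -eigenvalue_root_char.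
- rewrite map_inj_uniq ?iota_uniq // => i j /(mulIf a0)/invr_inj.
  exact: expr_not_unity_inj.
Qed.

(* Conjugation by K scales the spectrum of E by r, so 0 is the only eigenvalue. *)
Lemma skew_commute_nilpotent (F : closedFieldType) d (K E : 'M[F]_d) (r : F) :
    r != 0 -> (forall k, (0 < k)%N -> r ^+ k != 1) ->
    K \in unitmx -> E *m K = r *: (K *m E) -> E ^+ d = 0.
Proof.
move=> r0 hr uK EK.
have e0 a : eigenvalue E a -> a = 0 := @skew_commute_eigenvalue_eq0 _ _ _ _ _ _ r0 hr uK EK.
case: d => [|d] in K E uK EK e0 *; first exact: flatmx0.
have [rs] := closed_field_poly_normal (char_poly E).
rewrite (monicP (char_poly_monic E)) scale1r => Ers.
have rs0 z : z \in rs -> z = 0.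
  move=> zrs; apply: e0; rewrite eigenvalue_root_char Ers root_prod_XsubC //.
(* A monic polynomial that splits with all its roots zero is a power of X, and Cayley-Hamilton
   concludes. *)
have cE : char_poly E = 'X^(size rs).
  rewrite Ers (eq_big_seq (fun=> 'X)) => [|z /rs0 ->]; last by rewrite subr0.
  by rewrite big_const_seq count_predT iter_mulr_1.
have srs : size rs = d.+1.
  by have := size_char_poly E; rewrite cE size_polyXn => -[].
by have := Cayley_Hamilton E; rewrite cE srs rmorphXn /= horner_mx_X.
Qed.

Lemma nilpotent_last (R : pzRingType) d (E : 'M[R]_d) N (v : 'cV[R]_d) :
  E ^+ N = 0 -> v != 0 -> exists k, E ^+ k *m v != 0 /\ E ^+ k.+1 *m v = 0.
Proof.
move=> EN v0; have ex : exists k, E ^+ k *m v == 0 by exists N; rewrite EN mul0mx.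
case: (ex_minnP ex) => -[|k] /eqP Ek mink.
  by rewrite expr0 mul1mx in Ek; rewrite Ek eqxx in v0.
exists k; split=> //; apply/negP => /mink; by rewrite ltnn.
Qed.

(** * Strings of an sl2-type pair below a highest weight vector *)

Section Sl2.
Variables (q : C) (q0 : q != 0)
  (hq : forall k, (0 < k)%N -> q ^+ k != 1).
Lemma subrV_neq0 : q - q^-1 != 0.
Proof.
apply: contraNneq (hq 2 isT) => /eqP; rewrite subr_eq0 => /eqP e.
by rewrite expr2 {1}e mulVf.
Qed.

Lemma qint_neq0 n : (0 < n)%N -> qint q n != 0.
Proof.
move=> n0; rewrite /qint mulf_neq0 ?invr_eq0 ?subrV_neq0 // subr_eq0.
have h : (0 < n + n)%N by lia.
apply: contraNneq (hq _ h) => e; by rewrite exprD {1}e mulVf // expf_neq0.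
Qed.

(* x and y are the values on v of the two halves of the commutator: (K1, I K1^-1)
   for the first pair of generators, (I K2, K2^-1) for the second. *)
Lemma sl2_string_raise d (E Fm : 'M[C]_d) (v : 'cV[C]_d) x y :
  E *m v = 0 ->
  (forall i, (E *m Fm - Fm *m E) *m (Fm ^+ i *m v) =
    ((q - q^-1)^-1 * (x * q ^- i ^+ 2 - y * q ^+ i ^+ 2)) *: (Fm ^+ i *m v)) ->
  forall i, E *m (Fm ^+ i.+1 *m v) =
    (qint q i.+1 * ((x * q ^- i - y * q ^+ i) / (q - q^-1))) *: (Fm ^+ i *m v).
Proof.
move=> Ev H i.
have q2 : q * q - 1 != 0 by move: (hq 2 isT); rewrite subr_eq0.
have step j : E *m (Fm ^+ j.+1 *m v) =
    (E *m Fm - Fm *m E) *m (Fm ^+ j *m v) + Fm *m (E *m (Fm ^+ j *m v)).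
  by rewrite mulmxBl !mulmxA subrK exprS -!mulmxE !mulmxA.
elim: i => [|i IH]; rewrite step H.
  rewrite expr0 mul1mx Ev mulmx0 addr0; congr (_ *: _); rewrite /qint expr1.
  by field; rewrite ?q0 ?q2 ?oner_eq0.
(* Both terms are multiples of the same string vector. The coefficients add up by a rational
   identity in q and q^i, the latter treated as an independent nonzero variable. *)
rewrite IH -scalemxAr mulmxA mulmxE -exprS -scalerDl; congr (_ *: _).
have qi : q ^+ i != 0 by rewrite expf_neq0.
rewrite /qint !exprS; move: (q ^+ i) qi => a a0.
by field; rewrite ?q0 ?a0 ?q2 ?oner_eq0.
Qed.

(** The string ends at some [n]. The scalar [t] is the geometric mean of [x] and [y], later the
    parameter lambda up to sign. *)
Lemma sl2_string d (E Fm : 'M[C]_d) N (v : 'cV[C]_d) x y :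
  Fm ^+ N = 0 -> v != 0 -> E *m v = 0 ->
  (forall i, (E *m Fm - Fm *m E) *m (Fm ^+ i *m v) =
    ((q - q^-1)^-1 * (x * q ^- i ^+ 2 - y * q ^+ i ^+ 2)) *: (Fm ^+ i *m v)) ->
  exists n t, [/\ Fm ^+ n *m v != 0, Fm ^+ n.+1 *m v = 0,
    x = t * q ^+ n, y = t * q ^- n &
    forall i, (i <= n)%N -> E *m (Fm ^+ i *m v) =
      (t * qint q i * qint q (n - i + 1)) *: (Fm ^+ i.-1 *m v)].
Proof.
move=> FN v0 Ev H; have R := @sl2_string_raise _ _ _ _ _ _ Ev H.
have [n [Fn0 Fn]] := @nilpotent_last _ _ _ _ _ FN v0.
have q1 := subrV_neq0.
have qz k : q ^+ k != 0 by rewrite expf_neq0.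
have yE : y = x * q ^- n * q ^- n.
  (* [E] applied to the zero vector F^(n+1) v is a multiple of the nonzero F^n v. Since [n+1] is
     nonzero, x q^-n = y q^n. *)
  have /eqP := R n; rewrite Fn mulmx0 eq_sym scaler_eq0 (negbTE Fn0) orbF.
  rewrite mulf_eq0 (negbTE (@qint_neq0 _ _)) // mulf_eq0 invr_eq0 (negbTE q1) orbF.
  by rewrite subr_eq0 => /eqP ->; rewrite mulfK.
exists n, (x * q ^- n); split=> //; first by rewrite mulfVK.
(* At [i = 0] the truncated [i.-1] is harmless because [0] = 0. *)
case=> [|i] lin.
  by rewrite expr0 mul1mx Ev /qint expr0 invr1 subrr mul0r mulr0 mul0r scale0r.
rewrite R /= ; congr (_ *: _); rewrite yE.
have -> : (n - i.+1 + 1 = n - i)%N by lia.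
have -> : q ^+ n = q ^+ (n - i) * q ^+ i by rewrite -exprD subnK // ltnW.
rewrite /qint exprS; move: (q ^+ (n - i)) (q ^+ i) (qz (n-i)%N) (qz i) => a b a0 b0.
move: (hq 2 isT); rewrite -subr_eq0 => q2.
by field; rewrite q0 q2 a0 b0.
Qed.
End Sl2.

(** * Double indexing of the basis and maps out of the model space *)

Section Grid.
Variables (m n : nat).
Local Notation D := (m.+1 * n.+1)%N.
Local Notation fi a := (a %/ n.+1)%N.
Local Notation fj a := (a %% n.+1)%N.

Lemma grid_row_le (a : 'I_D) : (fi a <= m)%N.
Proof. by rewrite -ltnS ltn_divLR. Qed.

Lemma grid_col_le (a : 'I_D) : (fj a <= n)%N.
Proof. by rewrite -ltnS ltn_pmod. Qed.

Lemma grid_eq (a b : 'I_D) : (a == b) = (fi a == fi b) && (fj a == fj b).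
Proof.
apply/eqP/andP => [-> //|[/eqP ei /eqP ej]].
by apply: val_inj; rewrite /= (divn_eq a n.+1) ei ej -divn_eq.
Qed.

Lemma grid_index i j : (i <= m)%N -> (j <= n)%N ->
  exists a : 'I_D, fi a = i /\ fj a = j.
Proof.
move=> im jn; have lt : (i * n.+1 + j < D)%N by nia.
exists (Ordinal lt); rewrite /= divnMDl // divn_small // addn0.
by rewrite modnMDl modn_small.
Qed.

Variables (d : nat) (w : nat -> nat -> 'cV[C]_d).
Hypothesis w0 : forall i j, (m < i)%N || (n < j)%N -> w i j = 0.

(** Exactly one index has coordinates (i, j) on the grid and none off it, where [w] vanishes.
    Columns of the model matrices can thus be computed without separating the border cases. *)
Lemma sum_grid (c : C) i j :
  \sum_(a < D) (if (fi a == i) && (fj a == j) then c else 0) *: w (fi a) (fj a)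
    = c *: w i j.
Proof.
have [im|im] := leqP i m; last first.
  rewrite (w0 i j) ?im // scaler0 big1 // => a _; case: ifP; rewrite ?scale0r //.
  by case/andP=> /eqP ai; have := grid_row_le a; rewrite ai leqNgt im.
have [jn|jn] := leqP j n; last first.
  rewrite (w0 i j) ?jn ?orbT // scaler0 big1 // => a _; case: ifP; rewrite ?scale0r //.
  by case/andP=> _ /eqP aj; have := grid_col_le a; rewrite aj leqNgt jn.
have [b [bi bj]] := grid_index i j im jn.
rewrite (bigD1 b) //= bi bj !eqxx big1 ?addr0 // => a.
by rewrite grid_eq bi bj => /negbTE ->; rewrite scale0r.
Qed.

(** The matrix of the linear map sending v_i (x) v_j to [w i j]. *)
Definition grid_mx : 'M[C]_(d, D) := \matrix_(x, a) w (fi a) (fj a) x 0.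

Lemma grid_mx_intertwine (X : 'M[C]_D) (A : 'M[C]_d) :
  (forall b : 'I_D, \sum_a X a b *: w (fi a) (fj a) = A *m w (fi b) (fj b)) ->
  A *m grid_mx = grid_mx *m X.
Proof.
move=> H; apply/matrixP => x b.
have := congr1 (fun u : 'cV_d => u x 0) (H b); rewrite summxE !mxE => e.
transitivity (\sum_j A x j * w (fi b) (fj b) j 0).
  by apply: eq_bigr => j _; rewrite !mxE.
by rewrite -e; apply: eq_bigr => a _; rewrite !mxE mulrC.
Qed.

End Grid.

(** * The model module: action on columns and highest weight vectors *)

Section LmodTheory.
Variables (q : C) (q0 : q != 0) (hq : forall k, (0 < k)%N -> q ^+ k != 1).
Variables (m n : nat) (dl lam : C).
Local Notation D := (m.+1 * n.+1)%N.
Local Notation fi a := (a %/ n.+1)%N.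
Local Notation fj a := (a %% n.+1)%N.

(** Brings the integer exponents of the model weights to the natural powers in which [sl2_string]
    expresses them. *)
Lemma expz_weight k i : q ^ (k%:Z - i.*2%:Z) = q ^+ k * q ^- i ^+ 2.
Proof. by rewrite expfzDr // -exprnN -exprnP exprVn -exprM muln2. Qed.

Section Columns.
Variables (d : nat) (w : nat -> nat -> 'cV[C]_d).
Hypothesis w0 : forall i j, (m < i)%N || (n < j)%N -> w i j = 0.

Lemma qint0 : qint q 0 = 0.
Proof. by rewrite /qint expr0 invr1 subrr mul0r. Qed.

Lemma LE1_columns (b : 'I_D) :
  \sum_a LE1 q m n lam a b *: w (fi a) (fj a) =
  (lam * qint q (fi b) * qint q (m - fi b + 1)) *: w (fi b).-1 (fj b).
Proof.
rewrite -(sum_grid m n d w w0); apply: eq_bigr => a _; rewrite !mxE; congr (_ *: _).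
(* At the edge the truncated predecessor breaks the match of the two conditions, but [0] = 0 makes
   both sides vanish. *)
by case: (fi b) => [|i] //=; rewrite qint0 mulr0 mul0r if_same.
Qed.

Lemma LE2_columns (b : 'I_D) :
  \sum_a LE2 q m n dl lam a b *: w (fi a) (fj a) =
  (dl * lam * qint q (fj b) * qint q (n - fj b + 1)) *: w (fi b) (fj b).-1.
Proof.
rewrite -(sum_grid m n d w w0); apply: eq_bigr => a _; rewrite !mxE; congr (_ *: _).
by case: (fj b) => [|i] //=; rewrite qint0 mulr0 mul0r !if_same.
Qed.

Lemma LF1_columns (b : 'I_D) :
  \sum_a LF1 m n a b *: w (fi a) (fj a) = w (fi b).+1 (fj b).
Proof.
rewrite -[RHS]scale1r -(sum_grid m n d w w0).
by apply: eq_bigr => a _; rewrite !mxE.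
Qed.

Lemma LF2_columns (b : 'I_D) :
  \sum_a LF2 m n a b *: w (fi a) (fj a) = w (fi b) (fj b).+1.
Proof.
rewrite -[RHS]scale1r -(sum_grid m n d w w0).
by apply: eq_bigr => a _; rewrite !mxE.
Qed.

Lemma LK1_columns (b : 'I_D) :
  \sum_a LK1 q m n lam a b *: w (fi a) (fj a) =
  (lam * q ^+ m * q ^- (fi b) ^+ 2) *: w (fi b) (fj b).
Proof.
rewrite -(sum_grid m n d w w0); apply: eq_bigr => a _; rewrite !mxE.
by rewrite grid_eq expz_weight mulrA.
Qed.

Lemma LK2_columns (b : 'I_D) :
  \sum_a LK2 q m n dl lam a b *: w (fi a) (fj a) =
  (dl * lam^-1 * q ^+ n * q ^- (fj b) ^+ 2) *: w (fi b) (fj b).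
Proof.
rewrite -(sum_grid m n d w w0); apply: eq_bigr => a _; rewrite !mxE.
by rewrite grid_eq expz_weight mulrA.
Qed.

Lemma LI_columns (b : 'I_D) :
  \sum_a LI m n lam a b *: w (fi a) (fj a) = lam ^+ 2 *: w (fi b) (fj b).
Proof.
rewrite -(sum_grid m n d w w0); apply: eq_bigr => a _; rewrite !mxE.
by rewrite grid_eq.
Qed.
End Columns.

Lemma LK1_diag : LK1 q m n lam = diag_mx (\row_a (lam * (q ^+ m * q ^- (fi a) ^+ 2))).
Proof.
apply/matrixP => a b; rewrite !mxE expz_weight.
by case: eqP => [->|_]; rewrite ?mulr1n ?mulr0n.
Qed.

Lemma LK2_diag :
  LK2 q m n dl lam = diag_mx (\row_a (dl * lam^-1 * (q ^+ n * q ^- (fj a) ^+ 2))).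
Proof.
apply/matrixP => a b; rewrite !mxE expz_weight.
by case: eqP => [->|_]; rewrite ?mulr1n ?mulr0n.
Qed.

Lemma LI_diag : LI m n lam = diag_mx (const_mx (lam ^+ 2)).
Proof.
apply/matrixP => a b; rewrite !mxE.
by case: eqP => _; rewrite ?mulr1n ?mulr0n.
Qed.

Hypotheses (lam0 : lam != 0) (dl0 : dl != 0).

Lemma LK1_unit : LK1 q m n lam \in unitmx.
Proof.
rewrite LK1_diag unitmxE det_diag unitfE prodf_seq_neq0; apply/allP => a _ /=.
by rewrite mxE !mulf_neq0 // ?expf_neq0 ?invr_eq0 ?expf_neq0.
Qed.

Lemma LK2_unit : LK2 q m n dl lam \in unitmx.
Proof.
rewrite LK2_diag unitmxE det_diag unitfE prodf_seq_neq0; apply/allP => a _ /=.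
by rewrite mxE !mulf_neq0 // ?expf_neq0 ?invr_eq0 ?expf_neq0.
Qed.

Lemma LE1_LK1 : LE1 q m n lam *m LK1 q m n lam =
  q ^- 2 *: (LK1 q m n lam *m LE1 q m n lam).
Proof.
rewrite LK1_diag; apply/matrixP => a b.
rewrite mul_mx_diag [in RHS]mxE mul_diag_mx !mxE.
case: ifP => [/andP[/eqP <- _]|]; last by rewrite !(mul0r, mulr0).
rewrite [RHS]mulrA [LHS]mulrC; congr (_ * _).
rewrite (exprS q (_ %/ _)) invfM exprMn -(exprVn q 2); ring.
Qed.

Lemma LE2_LK2 : LE2 q m n dl lam *m LK2 q m n dl lam =
  q ^- 2 *: (LK2 q m n dl lam *m LE2 q m n dl lam).
Proof.
rewrite LK2_diag; apply/matrixP => a b.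
rewrite mul_mx_diag [in RHS]mxE mul_diag_mx !mxE.
case: ifP => [/andP[_ /eqP <-]|]; last by rewrite !(mul0r, mulr0).
rewrite [RHS]mulrA [LHS]mulrC; congr (_ * _).
rewrite (exprS q (_ %% _)) invfM exprMn -(exprVn q 2); ring.
Qed.

(** The coordinate of E1 x one step above [b] is the single term lam [i][m-i+1] x_b, whose
    coefficient is nonzero since q is not a root of unity. *)
Lemma LE1_ker (x : 'cV[C]_D) (b : 'I_D) :
  LE1 q m n lam *m x = 0 -> (0 < fi b)%N -> x b 0 = 0.
Proof.
move=> Ex b0; have [|a [ai aj]] := grid_index m n (fi b).-1 (fj b) _ (grid_col_le m n b).
  by have := grid_row_le m n b; lia.
have := congr1 (fun u : 'cV_D => u a 0) Ex; rewrite !mxE (bigD1 b) //= big1 => [|c].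
  rewrite addr0 mxE ai aj prednK // !eqxx /= => /eqP.
  rewrite mulf_eq0 => /orP[|/eqP//]; apply: contraTeq => _.
  by apply: mulf_neq0; [apply: mulf_neq0 => //|]; apply: qint_neq0 => //; rewrite addn1.
rewrite grid_eq mxE ai aj prednK // eq_sym [_ == fj b]eq_sym => /negbTE ->.
by rewrite mul0r.
Qed.

Lemma LE2_ker (x : 'cV[C]_D) (b : 'I_D) :
  LE2 q m n dl lam *m x = 0 -> (0 < fj b)%N -> x b 0 = 0.
Proof.
move=> Ex b0; have [|a [ai aj]] := grid_index m n (fi b) (fj b).-1 (grid_row_le m n b).
  by have := grid_col_le m n b; lia.
have := congr1 (fun u : 'cV_D => u a 0) Ex; rewrite !mxE (bigD1 b) //= big1 => [|c].
  rewrite addr0 mxE ai aj prednK // !eqxx /= => /eqP.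
  rewrite mulf_eq0 => /orP[|/eqP//]; apply: contraTeq => _.
  apply: mulf_neq0; [apply: mulf_neq0; [exact: mulf_neq0|]|];
    by apply: qint_neq0 => //; rewrite addn1.
rewrite grid_eq mxE ai aj prednK // eq_sym [_ == fj b]eq_sym => /negbTE ->.
by rewrite mul0r.
Qed.

(** E2 does not move the first coordinate, so raising by E2 keeps the support condition obtained
    from E1. *)
Lemma LE2_support (x : 'cV[C]_D) k :
  (forall b : 'I_D, (0 < fi b)%N -> x b 0 = 0) ->
  forall b : 'I_D, (0 < fi b)%N -> (LE2 q m n dl lam ^+ k *m x) b 0 = 0.
Proof.
move=> H; elim: k => [|k IH] b b0; first by rewrite expr0 mul1mx H.
rewrite exprS -mulmxE -mulmxA mxE big1 // => c _; rewrite [X in X * _]mxE.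
case: ifP => [/andP[/eqP bc _]|_]; last by rewrite mul0r.
by rewrite IH ?mulr0 // -bc.
Qed.

(* A nonzero vector of the kernel could be raised by E1, then by E2, to a
   nonzero multiple of the highest weight vector, which Q does not kill. *)
Lemma Lmod_intertwiner_inj d (Q : 'M[C]_(d, D)) (E1 E2 : 'M[C]_d) :
  E1 *m Q = Q *m LE1 q m n lam -> E2 *m Q = Q *m LE2 q m n dl lam ->
  (forall b : 'I_D, fi b = 0%N -> fj b = 0%N -> col b Q != 0) ->
  forall x : 'cV[C]_D, Q *m x = 0 -> x = 0.
Proof.
move=> QE1 QE2 Q0 x Qx; apply/eqP/negPn/negP => x0.
have r0 : q ^- 2 != 0 by rewrite invr_eq0 expf_neq0.
have hr k : (0 < k)%N -> q ^- 2 ^+ k != 1.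
  by move=> k0; rewrite exprVn -exprM invr_eq1 hq // muln_gt0.
have stable (E : 'M[C]_d) L k (y : 'cV_D) :
    E *m Q = Q *m L -> Q *m y = 0 -> Q *m (L ^+ k *m y) = 0.
  move=> QE Qy; elim: k => [|k IH]; first by rewrite expr0 mul1mx.
  by rewrite exprS -mulmxE -mulmxA mulmxA -QE -mulmxA IH mulmx0.
have N1 := @skew_commute_nilpotent _ _ _ _ _ r0 hr LK1_unit LE1_LK1.
have N2 := @skew_commute_nilpotent _ _ _ _ _ r0 hr LK2_unit LE2_LK2.
have [k [y0 Ey]] := nilpotent_last _ _ _ _ _ N1 x0.
have Qy := stable _ _ k _ QE1 Qx.
rewrite exprS -mulmxE -mulmxA in Ey.
have sy b := LE1_ker _ b Ey.
set y := _ *m x in y0 Ey Qy sy.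
have [l [z0 Ez]] := nilpotent_last _ _ _ _ _ N2 y0.
have Qz := stable _ _ l _ QE2 Qy.
have sz := LE2_support _ l sy.
rewrite exprS -mulmxE -mulmxA in Ez.
have tz b := LE2_ker _ b Ez.
set z := _ *m y in z0 Ez Qz sz tz; clearbody z.
have [b [bi bj]] := grid_index m n 0 0 (leq0n _) (leq0n _).
have zE : z = z b 0 *: delta_mx b 0.
  apply/colP => c; rewrite !mxE eqxx andbT.
  have [->|] := eqVneq c b; first by rewrite mulr1.
  rewrite grid_eq bi bj => /nandP cb; rewrite (_ : z c 0 = 0).
    by rewrite mulr0.
  by case: cb; rewrite -lt0n; [move/sz|move/tz].
have := Q0 b bi bj; rewrite colE; apply/negP/negPn.
move: Qz z0; rewrite zE -scalemxAr => /eqP; rewrite scaler_eq0 => /orP[/eqP->|//].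
by rewrite scale0r eqxx.
Qed.

(** A vector killed by E1 and E2 is supported at the index (0, 0), where the diagonal entries of K1,
    K2 and I give its weights. *)
Lemma Lmod_highest_weight (x : 'cV[C]_D) (al be ga : C) :
  x != 0 -> LE1 q m n lam *m x = 0 -> LE2 q m n dl lam *m x = 0 ->
  LK1 q m n lam *m x = al *: x -> LK2 q m n dl lam *m x = be *: x ->
  LI m n lam *m x = ga *: x ->
  [/\ al = lam * q ^+ m, be = dl * lam^-1 * q ^+ n & ga = lam ^+ 2].
Proof.
move=> x0 E1x E2x; have /cV0Pn[b xb] := x0.
have bi : fi b = 0%N.
  by case: (posnP (fi b)) => // /(LE1_ker _ _ E1x) e; rewrite e eqxx in xb.
have bj : fj b = 0%N.
  by case: (posnP (fj b)) => // /(LE2_ker _ _ E2x) e; rewrite e eqxx in xb.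
rewrite LK1_diag LK2_diag LI_diag !mul_diag_mx.
move=> /colP/(_ b) e1 /colP/(_ b) e2 /colP/(_ b) e3; move: e1 e2 e3.
rewrite !mxE bi bj expr0 invr1 expr1n !mulr1.
by move=> /(mulIf xb) -> /(mulIf xb) -> /(mulIf xb) ->.
Qed.

Lemma Lmod_has_highest_weight : exists x : 'cV[C]_D,
  [/\ x != 0, LE1 q m n lam *m x = 0 & LE2 q m n dl lam *m x = 0] /\
  [/\ LK1 q m n lam *m x = (lam * q ^+ m) *: x,
      LK2 q m n dl lam *m x = (dl * lam^-1 * q ^+ n) *: x &
      LI m n lam *m x = lam ^+ 2 *: x].
Proof.
have [b [bi bj]] := grid_index m n 0 0 (leq0n _) (leq0n _).
exists (delta_mx b 0); split; split.
- by apply/cV0Pn; exists b; rewrite mxE !eqxx oner_eq0.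
- by rewrite -colE; apply/colP => a; rewrite !mxE bi.
- by rewrite -colE; apply/colP => a; rewrite !mxE bj andbF.
- rewrite LK1_diag mul_diag_mx; apply/colP => a; rewrite !mxE eqxx andbT.
  by case: eqP => [->|_]; rewrite ?mulr0 // bi expr0 invr1 expr1n !mulr1.
- rewrite LK2_diag mul_diag_mx; apply/colP => a; rewrite !mxE eqxx andbT.
  by case: eqP => [->|_]; rewrite ?mulr0 // bj expr0 invr1 expr1n !mulr1.
- by rewrite LI_diag mul_diag_mx; apply/colP => a; rewrite !mxE.
Qed.

End LmodTheory.

(** * Weight vectors, their images under powers, and common eigenvectors *)

Lemma mulmx_exp_comm (R : pzRingType) d (A X : 'M[R]_d) k (v : 'cV[R]_d) :
  A *m X = X *m A -> A *m (X ^+ k *m v) = X ^+ k *m (A *m v).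
Proof. by move=> AX; rewrite !mulmxA !mulmxE (commrX _ AX). Qed.

Lemma weight_exp (R : comPzRingType) d (K X : 'M[R]_d) (r a : R) (v : 'cV[R]_d) k :
  K *m X = r *: (X *m K) -> K *m v = a *: v ->
  K *m (X ^+ k *m v) = (a * r ^+ k) *: (X ^+ k *m v).
Proof.
move=> KX Kv; elim: k => [|k IH]; first by rewrite !expr0 mul1mx mulr1.
rewrite exprS -mulmxE -mulmxA mulmxA KX -scalemxAl -mulmxA IH.
by rewrite -scalemxAr scalerA exprS mulrCA.
Qed.

Lemma weight_comm_exp (R : comPzRingType) d (K X : 'M[R]_d) (a : R) (v : 'cV[R]_d) k :
  K *m X = X *m K -> K *m v = a *: v -> K *m (X ^+ k *m v) = a *: (X ^+ k *m v).
Proof. by move=> KX Kv; rewrite mulmx_exp_comm // Kv scalemxAr. Qed.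

Lemma weight_neq0 (F : fieldType) d (K : 'M[F]_d) a (v : 'cV[F]_d) :
  K \in unitmx -> v != 0 -> K *m v = a *: v -> a != 0.
Proof.
move=> uK v0 Kv; apply: contraNneq v0 => a0.
by rewrite -(mulKmx uK v) Kv a0 scale0r mulmx0.
Qed.

Lemma weight_invmx (F : fieldType) d (K : 'M[F]_d) a (v : 'cV[F]_d) :
  K \in unitmx -> a != 0 -> K *m v = a *: v -> invmx K *m v = a^-1 *: v.
Proof.
move=> uK a0 Kv; rewrite -{2}(mulKmx uK v) Kv -scalemxAr scalerA mulVf //.
by rewrite scale1r.
Qed.

(** An invertible [K] preserves rank, so stability of [U] forces U K = U. This covers the inverse
    generators in [wgens]. *)
Lemma stablemx_invmx (F : fieldType) m d (U : 'M[F]_(m, d)) (K : 'M[F]_d) :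
  K \in unitmx -> (U *m K <= U)%MS -> (U *m invmx K <= U)%MS.
Proof.
move=> uK UK; have e := mxrank_leqif_sup UK.
have : (U <= U *m K)%MS.
  by rewrite -(geq_leqif e) mxrankMfree // row_free_unit.
by move/(submxMr (invmx K)); rewrite mulmxK.
Qed.

Lemma common_eigenvector3 d (A B D : 'M[C]_d) : (0 < d)%N ->
  A *m B = B *m A -> A *m D = D *m A -> B *m D = D *m B ->
  exists (v : 'cV[C]_d) (a b c : C),
    [/\ v != 0, A *m v = a *: v, B *m v = b *: v & D *m v = c *: v].
Proof.
move=> d0 AB AD BD.
(* [common_eigenvector] yields row vectors, hence the transposes. *)
have [|v v0] := @common_eigenvector _ d [:: A^T; B^T; D^T] d0.
  move=> X Y; rewrite !inE => /or3P[]/eqP-> /or3P[]/eqP->;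
  by rewrite /comm_mx -!trmx_mul ?AB ?AD ?BD.
rewrite /= andbT => /and3P[/sub_rVP[a va] /sub_rVP[b vb] /sub_rVP[c vc]].
exists v^T, a, b, c; split; first by rewrite -[_ == 0]trmx_eq0 trmxK.
- by apply: trmx_inj; rewrite trmx_mul trmxK va linearZ /= trmxK.
- by apply: trmx_inj; rewrite trmx_mul trmxK vb linearZ /= trmxK.
- by apply: trmx_inj; rewrite trmx_mul trmxK vc linearZ /= trmxK.
Qed.

(** * Intertwiners into an irreducible module *)

(** The image of [Q] is a nonzero submodule of [V], hence everything. As [Q] acts on columns,
    [row_free] expresses surjectivity, and the row space of [Q^T] is the image. *)
Lemma wirreducible_intertwiner_row_free (V W : wrep)
    (Q : 'M[C]_(wdim V, wdim W)) (q : C) :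
  is_Wmod q V -> wirreducible V -> Q != 0 ->
  [/\ wE1 V *m Q = Q *m wE1 W, wE2 V *m Q = Q *m wE2 W,
      wF1 V *m Q = Q *m wF1 W & wF2 V *m Q = Q *m wF2 W] ->
  [/\ wK1 V *m Q = Q *m wK1 W, wK2 V *m Q = Q *m wK2 W &
      wI V *m Q = Q *m wI W] ->
  row_free Q.
Proof.
move=> [[uK1 uK2 uI] _] [_ irr] Q0 [e1 e2 f1 f2] [k1 k2 ki].
have st A L : A *m Q = Q *m L -> (<<Q^T>> *m A^T <= <<Q^T>>)%MS.
  move=> e; rewrite genmxE (eqmxMr _ (genmxE _)) -trmx_mul e trmx_mul.
  exact: submxMl.
have si A L : A \in unitmx -> A *m Q = Q *m L ->
    (<<Q^T>> *m (invmx A)^T <= <<Q^T>>)%MS.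
  by move=> uA e; rewrite trmx_inv stablemx_invmx ?unitmx_tr //; apply: st e.
have [|U0|] := irr <<Q^T>>%MS.
- move=> A; rewrite !inE.
  do 9?[case/orP; first by move/eqP->; eauto]; by move/eqP->; eauto.
- case/eqP: Q0; apply: trmx_inj; apply/eqP; rewrite trmx0.
  by rewrite -submx0 -(genmxE Q^T) U0 sub0mx.
- by rewrite /row_full /row_free mxrank_gen mxrank_tr.
Qed.

(** [Q] maps [W] to [V], so its inverse serves as the isomorphism from [V]. *)
Lemma wiso_of_bijective (V W : wrep) (Q : 'M[C]_(wdim V, wdim W)) :
  row_free Q -> row_full Q ->
  [/\ wE1 V *m Q = Q *m wE1 W, wE2 V *m Q = Q *m wE2 W,
      wF1 V *m Q = Q *m wF1 W & wF2 V *m Q = Q *m wF2 W] ->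
  [/\ wK1 V *m Q = Q *m wK1 W, wK2 V *m Q = Q *m wK2 W &
      wI V *m Q = Q *m wI W] ->
  wiso V W.
Proof.
move=> /row_freeP[P QP] /row_fullP[P' PQ] [e1 e2 f1 f2] [k1 k2 ki].
have PE : P' = P by rewrite -[P']mulmx1 -QP mulmxA PQ mul1mx.
rewrite {}PE in PQ.
have tr (A : 'M[C]_(wdim V)) L : A *m Q = Q *m L -> P *m A = L *m P.
  by move=> e; rewrite -[P *m A]mulmx1 -QP mulmxA -(mulmxA P) e !mulmxA PQ mul1mx.
exists P, Q; split=> //; split; exact: tr.
Qed.

(** * Uniqueness of the parameters *)

(** The composite [P' *m Q] carries a highest weight vector of one model to a highest weight vector
    of the other, with the same weights. *)
Lemma wiso_Lmod_highest_weight (q : C) (hq0 : q != 0)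
    (hq : forall k : nat, (0 < k)%N -> q ^+ k != 1) (V : wrep)
    (m n : nat) (dl lam : C) (m' n' : nat) (dl' lam' : C) :
  dl != 0 -> lam != 0 -> dl' != 0 -> lam' != 0 ->
  wiso V (Lmod q m n dl lam) -> wiso V (Lmod q m' n' dl' lam') ->
  [/\ lam * q ^+ m = lam' * q ^+ m',
      dl * lam^-1 * q ^+ n = dl' * lam'^-1 * q ^+ n' & lam ^+ 2 = lam' ^+ 2].
Proof.
move=> dl0 lam0 dl'0 lam'0.
move=> [P [Q [PQ QP [/= e1 e2 _ _] [/= k1 k2 ki]]]].
move=> [P' [Q' [PQ' QP' [/= e1' e2' _ _] [/= k1' k2' ki']]]].
have tr X L L' : P *m X = L *m P -> P' *m X = L' *m P' ->
    forall x : 'cV_(m.+1 * n.+1), L' *m (P' *m Q *m x) = P' *m Q *m (L *m x).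
  move=> h h' x; rewrite !mulmxA -h' -!mulmxA; congr (_ *m _); rewrite !mulmxA.
  congr (_ *m _).
  by rewrite -[X *m Q]mul1mx -QP -!mulmxA (mulmxA P X) h -mulmxA PQ mulmx1.
have [x [[x0 E1x E2x] [K1x K2x Ix]]] := Lmod_has_highest_weight q hq0 m n dl lam.
apply: (@Lmod_highest_weight q hq0 hq m' n' dl' lam' lam'0 dl'0 (P' *m Q *m x)).
- apply: contraNneq x0 => e; have := congr1 (mulmx (P *m Q')) e.
  by rewrite mulmx0 -!mulmxA (mulmxA Q') QP' mul1mx (mulmxA P) PQ mul1mx => ->.
- by rewrite (tr _ _ _ e1 e1') E1x mulmx0.
- by rewrite (tr _ _ _ e2 e2') E2x mulmx0.
- by rewrite (tr _ _ _ k1 k1') K1x scalemxAr.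
- by rewrite (tr _ _ _ k2 k2') K2x scalemxAr.
- by rewrite (tr _ _ _ ki ki') Ix scalemxAr.
Qed.

Lemma Lmod_unique (q : C) (hq0 : q != 0)
    (hq : forall k : nat, (0 < k)%N -> q ^+ k != 1) (V : wrep)
    (m n : nat) (dl lam : C) (m' n' : nat) (dl' lam' : C) :
  dl = 1 \/ dl = -1 -> lam != 0 -> wiso V (Lmod q m n dl lam) ->
  dl' = 1 \/ dl' = -1 -> lam' != 0 -> wiso V (Lmod q m' n' dl' lam') ->
  [/\ m = m', n = n', dl = dl' & lam = lam'].
Proof.
move=> hd lam0 iso hd' lam'0 iso'.
have sg (e : C) : e = 1 \/ e = -1 -> e != 0 /\ e ^+ 2 = 1.
  by case=> ->; rewrite ?oppr_eq0 oner_eq0 ?sqrrN expr1n.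
have [dl0 dlS] := sg _ hd; have [dl'0 dl'S] := sg _ hd'.
have [h1 h2 h3] := wiso_Lmod_highest_weight q hq0 hq V
  _ _ _ _ _ _ _ _ dl0 lam0 dl'0 lam'0 iso iso'.
have inj i j : q ^+ i ^+ 2 = q ^+ j ^+ 2 -> i = j.
  rewrite -!exprM => /(expr_not_unity_inj _ _ hq0 hq)/eqP.
  by rewrite eqn_pmul2r // => /eqP.
have mm : m = m'.
  apply: inj; have := congr1 (fun z => z ^+ 2) h1; rewrite !exprMn h3.
  by apply: mulfI; rewrite expf_neq0.
have nn : n = n'.
  apply: inj; have := congr1 (fun z => z ^+ 2) h2; rewrite !exprMn !exprVn h3 dlS dl'S.
  by apply: mulfI; rewrite mul1r invr_eq0 expf_neq0.
(* Once m and n agree, the unsquared equations give lambda, then delta. *)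
rewrite -mm in h1; rewrite -nn in h2.
have ll : lam = lam' by apply: (mulIf _ h1); rewrite expf_neq0.
split=> //; move: h2; rewrite ll => /(mulIf (expf_neq0 _ hq0)).
by apply: mulIf; rewrite invr_eq0.
Qed.

(** * Existence of an isomorphism with a model *)

Lemma Lmod_exists (q : C) (hq0 : q != 0)
    (hq : forall k : nat, (0 < k)%N -> q ^+ k != 1)
    (V : wrep) (HV : is_Wmod q V) (Hirr : wirreducible V) :
  exists (m n : nat) (dl lam : C),
    [/\ dl = 1 \/ dl = -1, lam != 0 & wiso V (Lmod q m n dl lam)].
Proof.
have [[uK1 uK2 uI] [[[ie1 ie2 if1 if2] [ik1 ik2]] [k1e2 k1f2 k1k2 k2e1 k2f1]
  [e1k1 k1f1 e2k2 k2f2] [e12 e1f2 f1e2 f12] [ef1 ef2]]] := HV.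
have [d0 _] := Hirr.
have comm (x y : 'M[C]_(wdim V)) : mcomm x y = 0 -> x *m y = y *m x.
  by move/subr0_eq.
(* For nilpotency, [skl] serves E1 and E2 with ratio q^-2, [skr] serves F1 and F2 with ratio q^2.
   For shifting weights the roles are exchanged. *)
have skl (x y : 'M[C]_(wdim V)) : qmcomm q x y = 0 -> x *m y = q ^- 2 *: (y *m x).
  move/subr0_eq/(congr1 (GRing.scale q^-1)); rewrite !scalerA mulVf // scale1r => ->.
  by rewrite exprS expr1 invfM.
have skr (x y : 'M[C]_(wdim V)) : qmcomm q x y = 0 -> y *m x = q ^+ 2 *: (x *m y).
  move/skl => ->; rewrite scalerA mulfV ?scale1r // expf_neq0 //.
have q20 : q ^+ 2 != 0 by rewrite expf_neq0.
have r0 : q ^- 2 != 0 by rewrite invr_eq0.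
have hr2 k : (0 < k)%N -> (q ^+ 2) ^+ k != 1.
  by move=> k0; rewrite -exprM hq // muln_gt0.
have hr k : (0 < k)%N -> q ^- 2 ^+ k != 1.
  by move=> k0; rewrite exprVn invr_eq1 hr2.
have N1 := @skew_commute_nilpotent _ _ _ _ _ r0 hr uK1 (skl _ _ e1k1).
have N2 := @skew_commute_nilpotent _ _ _ _ _ r0 hr uK2 (skl _ _ e2k2).
have M1 := @skew_commute_nilpotent _ _ _ _ _ q20 hr2 uK1 (skr _ _ k1f1).
have M2 := @skew_commute_nilpotent _ _ _ _ _ q20 hr2 uK2 (skr _ _ k2f2).
have [u [a0 [b0 [c [u0 K1u K2u Iu]]]]] :=
  common_eigenvector3 _ _ _ _ d0 (comm _ _ k1k2) (esym (comm _ _ ik1)) (esym (comm _ _ ik2)).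
have [k [u1 E1u]] := nilpotent_last _ _ _ _ _ N1 u0.
have [l [v0 E2v]] := nilpotent_last _ _ _ _ _ N2 u1.
rewrite exprS -mulmxE -mulmxA in E1u; rewrite exprS -mulmxE -mulmxA in E2v.
have K1u1 := weight_exp _ _ _ _ _ _ _ k (skr _ _ e1k1) K1u.
have K2u1 := weight_comm_exp _ _ _ _ _ _ k (comm _ _ k2e1) K2u.
have Iu1 := weight_comm_exp _ _ _ _ _ _ k (comm _ _ ie1) Iu.
have K1v := weight_comm_exp _ _ _ _ _ _ l (comm _ _ k1e2) K1u1.
have K2v := weight_exp _ _ _ _ _ _ _ l (skr _ _ e2k2) K2u1.
have Iv := weight_comm_exp _ _ _ _ _ _ l (comm _ _ ie2) Iu1.
(* Since E1 and E2 commute, raising by E2 keeps the vector in the kernel of E1. *)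
have E1v := mulmx_exp_comm _ _ _ _ l (wE1 V ^+ k *m u) (comm _ _ e12).
rewrite E1u mulmx0 in E1v.
move: v0 E2v K1v K2v Iv E1v; set v := _ *m (_ *m u).
set a := a0 * _; set b := b0 * _; clearbody v a b.
move=> v0 E2v K1v K2v Iv E1v {u u0 K1u K2u Iu u1 E1u K1u1 K2u1 Iu1 k l a0 b0 N1 N2}.
have c0 := weight_neq0 _ _ _ _ _ uI v0 Iv.
have a0 := weight_neq0 _ _ _ _ _ uK1 v0 K1v.
have b0 := weight_neq0 _ _ _ _ _ uK2 v0 K2v.
have K1F i := weight_exp _ _ _ _ _ _ _ i (skl _ _ k1f1) K1v.
have K2F i := weight_exp _ _ _ _ _ _ _ i (skl _ _ k2f2) K2v.
have IF1 i := weight_comm_exp _ _ _ _ _ _ i (comm _ _ if1) Iv.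
have IF2 i := weight_comm_exp _ _ _ _ _ _ i (comm _ _ if2) Iv.
have sq i : q ^- 2 ^+ i = q ^- i ^+ 2 by rewrite !exprVn -!exprM mulnC.
have sqV i : (q ^- i ^+ 2)^-1 = q ^+ i ^+ 2 by rewrite exprVn invrK.
have qi0 i : q ^- i ^+ 2 != 0 by rewrite expf_neq0 // invr_eq0 expf_neq0.
(* On [v], K1 and I K1^-1 have eigenvalues [a] and [c / a]; each application of F1 multiplies them
   by q^-2 and q^2. *)
have [|m [t [Fm0 Fm at_ ct E1F]]] := sl2_string q hq0 hq _ _ _ _ v a (c / a) M1 v0 E1v.
  move=> i; rewrite [X in X *m _]ef1 -scalemxAl -scalerA; congr (_ *: _).
  rewrite mulmxBl K1F -mulmxA (weight_invmx _ _ _ _ _ uK1 _ (K1F i)); last first.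
    by rewrite sq mulf_neq0.
  by rewrite -scalemxAr IF1 scalerA -scalerBl sq invfM sqV; congr (_ *: _); ring.
have [|n [t' [Fn0 Fn bt bt' E2F]]] := sl2_string q hq0 hq _ _ _ _ v (c * b) (b^-1) M2 v0 E2v.
  move=> i; rewrite [X in X *m _]ef2 -scalemxAl -scalerA; congr (_ *: _).
  rewrite mulmxBl -mulmxA (weight_invmx _ _ _ _ _ uK2 _ (K2F i)); last first.
    by rewrite sq mulf_neq0.
  rewrite K2F -scalemxAr IF2 scalerA -scalerBl sq invfM sqV; congr (_ *: _); ring.
have qz i : q ^+ i != 0 by rewrite expf_neq0.
have t0 : t != 0 by apply: contraNneq a0 => t0; rewrite at_ t0 mul0r.
(* [c] is the product of [a] and [c / a], and also of [c * b] and [b^-1]. Each pair has its q-powers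
   cancel, so t^2 = c = t'^2. *)
have cE : c = t ^+ 2.
  by rewrite -(mulfVK a0 c) ct at_ mulrA -(mulrA t) [_ * t]mulrC mulrA mulfVK.
have cE' : c = t' ^+ 2.
  by rewrite -(mulfK b0 c) bt bt' mulrA [_ * t']mulrC mulrA mulfK.
have t'0 : t' != 0 by apply: contraNneq c0 => t'0; rewrite cE' t'0 expr0n.
pose dl := t' / t.
have dlE : dl = 1 \/ dl = -1.
  have : dl ^+ 2 == 1 by rewrite expr_div_n -cE -cE' divff.
  by rewrite sqrf_eq1 => /orP[]/eqP; [left|right].
have t'E : t' = dl * t by rewrite mulfVK.
have dl0 : dl != 0 by rewrite mulf_neq0 // invr_eq0.
have bE : b = dl * t^-1 * q ^+ n.
  apply: (mulfI c0); rewrite bt cE t'E; field.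
  exact: t0.
pose w i j := wF1 V ^+ i *m (wF2 V ^+ j *m v).
(* Either order of F1 and F2 is available: the generators of the first pair act on the F1-outer or
   F1-inner form as commutation requires, and likewise for the second. *)
have wC i j : w i j = wF2 V ^+ j *m (wF1 V ^+ i *m v).
  rewrite /w mulmx_exp_comm //; exact/esym/commrX/esym/comm.
have w0 i j : (m < i)%N || (n < j)%N -> w i j = 0.
  case/orP=> lt; [rewrite wC -(subnK lt)|rewrite /w -(subnK lt)];
  by rewrite exprD -mulmxE -(mulmxA _ _ v) ?Fm ?Fn !mulmx0.
pose Q := grid_mx m n _ w.
have HQ := grid_mx_intertwine m n _ w.
have QE1 : wE1 V *m Q = Q *m LE1 q m n t.
  apply: HQ => b'; rewrite (LE1_columns q _ _ _ _ _ w0).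
  rewrite !wC (mulmx_exp_comm _ _ (wE1 V)); last by apply: comm.
  by rewrite E1F ?grid_row_le // scalemxAr.
have QE2 : wE2 V *m Q = Q *m LE2 q m n dl t.
  apply: HQ => b'; rewrite (LE2_columns q _ _ _ _ _ _ w0).
  rewrite /w (mulmx_exp_comm _ _ (wE2 V)); last by apply/esym; apply: comm.
  by rewrite E2F ?grid_col_le // -t'E scalemxAr.
have QF1 : wF1 V *m Q = Q *m LF1 m n.
  apply: HQ => b'; rewrite (LF1_columns _ _ _ _ w0).
  by rewrite /w exprS -mulmxE -(mulmxA (wF1 V)).
have QF2 : wF2 V *m Q = Q *m LF2 m n.
  apply: HQ => b'; rewrite (LF2_columns _ _ _ _ w0).
  by rewrite !wC exprS -mulmxE -(mulmxA (wF2 V)).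
have QK1 : wK1 V *m Q = Q *m LK1 q m n t.
  apply: HQ => b'; rewrite (LK1_columns q hq0 _ _ _ _ _ w0).
  rewrite !wC (mulmx_exp_comm _ _ (wK1 V)); last by apply: comm.
  by rewrite K1F sq -at_ scalemxAr.
have QK2 : wK2 V *m Q = Q *m LK2 q m n dl t.
  apply: HQ => b'; rewrite (LK2_columns q hq0 _ _ _ _ _ _ w0).
  rewrite /w (mulmx_exp_comm _ _ (wK2 V)); last by apply: comm.
  by rewrite K2F sq -bE scalemxAr.
have QI : wI V *m Q = Q *m LI m n t.
  apply: HQ => b'; rewrite (LI_columns _ _ _ _ _ w0).
  rewrite /w (mulmx_exp_comm _ _ (wI V)); last by apply: comm.
  by rewrite IF2 -cE scalemxAr.
(* The column of [Q] at the index (0, 0) is [v] itself. *)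
have Q0 (b' : 'I_(m.+1 * n.+1)) : (b' %/ n.+1 = 0)%N -> (b' %% n.+1 = 0)%N -> col b' Q != 0.
  move=> bi bj; apply: contraNneq v0 => /colP e; apply/eqP/colP => x.
  by have := e x; rewrite mxE [Q _ _]mxE bi bj /w !expr0 !mul1mx.
exists m, n, dl, t; split=> //.
apply: (@wiso_of_bijective V (Lmod q m n dl t) Q) => //.
  apply: (@wirreducible_intertwiner_row_free V (Lmod q m n dl t) Q q) => //.
  have [b' [bi bj]] := grid_index m n 0 0 (leq0n _) (leq0n _).
  by apply: contraNneq (Q0 _ bi bj) => ->; rewrite col0.
(* Injectivity of [Q] on columns is row freeness of its transpose. *)
have : row_free Q^T.
  apply: inj_row_free => y yQ; apply: trmx_inj; rewrite trmx0.
  apply: (@Lmod_intertwiner_inj q hq0 hq m n dl t t0 dl0 _ Q _ _ QE1 QE2 Q0).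
  by rewrite -[Q]trmxK -trmx_mul yQ trmx0.
by rewrite /row_free /row_full mxrank_tr.
Qed.

Theorem mainTheorem8 (q : C) (hq0 : q != 0)
    (hq : forall k : nat, (0 < k)%N -> q ^+ k != 1)
    (V : wrep) (HV : is_Wmod q V) (Hirr : wirreducible V) :
  (exists (m n : nat) (dl lam : C),
      [/\ dl = 1 \/ dl = -1, lam != 0 & wiso V (Lmod q m n dl lam)]) /\
  (forall (m n : nat) (dl lam : C) (m' n' : nat) (dl' lam' : C),
      dl = 1 \/ dl = -1 -> lam != 0 -> wiso V (Lmod q m n dl lam) ->
      dl' = 1 \/ dl' = -1 -> lam' != 0 -> wiso V (Lmod q m' n' dl' lam') ->
      [/\ m = m', n = n', dl = dl' & lam = lam']).
Proof.
split; first exact: Lmod_exists.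
move=> m n dl lam m' n' dl' lam'; exact: Lmod_unique.
Qed.
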